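(* Let $\kappa \in \mathcal{S}_{-1}$, let $k$ be its associate Sonine kernel, and let $n\in\mathbb{N}$. Then the relation $$(\mathbb{I}_{(\kappa)}^n\, {}_*\mathbb{D}_{(k)}^n\, f)(t) = f(t)-\sum_{j=0}^{n-1} f^{(j)}(0)\,\frac{t^{j}}{j!},\quad t>0,$$ holds true for any function $f\in C_{-1}^n(0,+\infty)$.
   Context: $C_{-1}(0,+\infty)$ is the set of functions $f$ on $(0,+\infty)$ that can be written as $f(t)=t^{p-1}f_1(t)$, $t>0$, for some $p>0$ and some $f_1\in C[0,+\infty)$. $C_{-1,0}(0,+\infty)$ is the set of functions $f$ on $(0,+\infty)$ that can be written as $f(t)=t^{p-1}f_1(t)$, $t>0$, for some $0<p<1$ and some $f_1\in C[0,+\infty)$. (The exponents $p$ depend on $f$.) For $n\in\mathbb{N}=\{1,2,\dots\}$, $C_{-1}^n(0,+\infty)$ is the set of functions $f$ on $(0,+\infty)$ with $f^{(n)}\in C_{-1}(0,+\infty)$; for such $f$ the finite limits $f^{(j)}(0):=\lim_{t\to0+}f^{(j)}(t)$, $0\le j\le n-1$, exist. The Laplace convolution is $(f*g)(t)=\int_0^t f(t-\tau)g(\tau)\,d\tau$, $t>0$. For $\kappa\in C_{-1}(0,+\infty)$, $\kappa^n:=\underbrace{\kappa*\cdots*\kappa}_{n}$ denotes the $n$-th convolution power (not the pointwise power). $\kappa\in\mathcal{S}_{-1}$ means that $\kappa\in C_{-1,0}(0,+\infty)$ and there is $k\in C_{-1,0}(0,+\infty)$ with $(\kappa*k)(t)=1$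 for all $t>0$ (the Sonine condition). Such a $k$ is unique and is called the associate Sonine kernel of $\kappa$. The $n$-fold general fractional integral with kernel $\kappa$ is the $n$-fold composition of $f\mapsto\kappa*f$, i.e. $(\mathbb{I}_{(\kappa)}^n f)(t)=(\kappa^n*f)(t)$, $t>0$. The $n$-fold general fractional derivative in the Caputo sense is $$({}_*\mathbb{D}_{(k)}^n f)(t):=\frac{d^n}{dt^n}(k^n*f)(t)-\sum_{j=0}^{n-1}f^{(j)}(0)\,\frac{d^{n-j-1}}{dt^{n-j-1}}k^n(t),\qquad t>0.$$
   Formalization: The formal theorem additionally assumes that, for each j<n with f^(j)(0)≠0, k^n is (n-j-1)-times differentiable on (0,+∞), so that the formula defining the Caputo derivative has a value; this can fail for n≥2. *)

(* Defs.v *)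
From HB Require Import structures.
From mathcomp Require Import all_boot all_order all_algebra.
From mathcomp Require Import all_classical all_reals all_analysis.

Set Implicit Arguments.
Unset Strict Implicit.
Unset Printing Implicit Defensive.

Import Order.TTheory GRing.Theory Num.Theory.
Import numFieldNormedType.Exports.

Local Open Scope classical_set_scope.
Local Open Scope ring_scope.

(* A real function on (0, +oo) is represented by a total function R -> R whose
   values outside (0, +oo) are never used: every notion below only depends on
   the restriction of its arguments to (0, +oo). *)

Section GeneralFractionalCalculus.
Context {R : realType}.
Implicit Types (f g k kappa : R -> R) (n j : nat).

(* C_{-1}(0, +oo) *)
Definition Cm1 f : Prop :=
  exists (p : R) (f1 : R -> R),
    [/\ 0 < p, {within `[0, +oo[, continuous f1}
      & forall t, 0 < t -> f t = t `^ (p - 1) * f1 t].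

(* C_{-1,0}(0, +oo) *)
Definition Cm1_0 f : Prop :=
  exists (p : R) (f1 : R -> R),
    [/\ 0 < p < 1, {within `[0, +oo[, continuous f1}
      & forall t, 0 < t -> f t = t `^ (p - 1) * f1 t].

(* f is n times differentiable at every point of (0, +oo). *)
Definition nderivable n f : Prop :=
  forall i, (i < n)%N -> forall t, 0 < t -> derivable (derive1n i f) t 1.

(* C_{-1}^n(0, +oo) *)
Definition Cm1n n f : Prop := nderivable n f /\ Cm1 (derive1n n f).

(* f^(j)(0), the limit from the right of f^(j) at 0 *)
Definition derive1n0p j f : R := lim (derive1n j f t @[t --> 0^'+]).

(* Integration is over the open interval (0, t), so that the possible
   singularities of g at 0 and of f(t - .) at t play no role. *)
Definition conv f g (t : R) : R :=
  \int[lebesgue_measure]_(tau in `]0, t[) (f (t - tau) * g tau).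

(* Convolution power k * ... * k with n factors, for n >= 1; there is no unit
   for the convolution among functions, and the value at n = 0 (which is k) is
   never used. *)
Definition conv_pow k n : R -> R := iter n.-1 (conv k) k.

(* k is the associate Sonine kernel of kappa *)
Definition associate_sonine kappa k : Prop :=
  Cm1_0 k /\ forall t, 0 < t -> conv kappa k t = 1.

(* kappa belongs to S_{-1} *)
Definition Sm1 kappa : Prop :=
  Cm1_0 kappa /\ exists k, associate_sonine kappa k.

(* n-fold general fractional integral *)
Definition gfi kappa n f : R -> R := iter n (conv kappa) f.

(* n-fold general fractional derivative in the Caputo sense *)
Definition caputo_gfd k n f (t : R) : R :=
  derive1n n (conv (conv_pow k n) f) t
  - \sum_(j < n) derive1n0p j f * derive1n (n - j - 1) (conv_pow k n) t.

(* The formula for caputo_gfd is meaningful: the derivatives of the n-th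
   convolution power of k that occur in it with a nonzero coefficient exist.
   This is automatic for n = 1, and for every n if f^(j)(0) = 0 for all j < n.
   In general it can fail, since k is only assumed to be continuous on (0, +oo),
   and then derive1n is a default value.  For f in C_{-1}^n it implies that the
   n-th derivative of (k^n * f) exists on (0, +oo) as well, and conversely. *)
Definition caputo_gfd_defined k n f : Prop :=
  forall j, (j < n)%N -> derive1n0p j f != 0 ->
    nderivable (n - j - 1) (conv_pow k n).

End GeneralFractionalCalculus.

(* Main.v *)
(* Modulo its Taylor polynomial at 0, f is the n-fold integral 1^n * f^(n), where
   1 is the constant function.  Since t^j/j! = 1^(j+1), one has
     k^n * f = sum_j f^(j)(0) (1^(j+1) * k^n) + 1^n * (k^n * f^(n)),
   and differentiating n times, with (1 * b)' = b, the Caputo derivative is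
   exactly k^n * f^(n).  By commutativity, associativity and kappa * k = 1,
   kappa^n * (k^n * f^(n)) = 1^n * f^(n) = f - Taylor polynomial. *)

From HB Require Import structures.
Require Import Defs.
From mathcomp Require Import all_boot all_order all_algebra.
From mathcomp Require Import all_classical all_reals all_analysis.
From mathcomp Require Import measurable_realfun.
From mathcomp Require Import ring lra.

Import Order.TTheory GRing.Theory Num.Theory.
Import numFieldNormedType.Exports.

Local Open Scope classical_set_scope.
Local Open Scope ring_scope.
Set Implicit Arguments.
Unset Strict Implicit.
Unset Printing Implicit Defensive.

(** * Reflections and translations of the Lebesgue integral *)

Section Reflection.
Context {R : realType}.
Implicit Types (f : R -> \bar R) (c : R).
Local Notation mu := (@lebesgue_measure R).

(** All identities are claimed at each t > 0, while Fubini controls a convolution only for almost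
    every t. Hence [locint] pairs continuity on (0, +oo) with local integrability: continuity makes
    (1 * b)' = b true at every point, integrability gives access to Fubini, and convolution
    preserves the pair. Extension by zero turns convolutions into integrals over a domain that does
    not move with t; there commutativity is a reflection, and associativity a translation combined
    with Fubini. The other obstacle is that k^n need not be differentiable. In the expansion of k^n
    * f, the summand of index j is n times differentiable once k^n is n-j-1 times so, which
    [caputo_gfd_defined] grants when f^(j)(0) is nonzero; otherwise the summand is the zero
    function. *)

Let flip_at c : measurableTypeR R -> measurableTypeR R := fun x => c - x.

Lemma measurable_fun_reflect c :
  measurable_fun setT (flip_at c).
Proof. by apply: measurable_funB. Qed.

(** By uniqueness of Lebesgue measure it suffices to test intervals []a, b]], whose preimage [[c -
    b, c - a[] has the same length. *)
Lemma lebesgue_measure_reflect c (A : set R) : measurable A ->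
  pushforward mu (flip_at c) A = mu A.
Proof.
pose HBmu := isMeasurableFun.Build _ _ _ _ _ (measurable_fun_reflect c).
pose phi : {mfun measurableTypeR R >-> measurableTypeR R} :=
  HB.pack (flip_at c) HBmu.
move=> mA; apply/esym.
apply: (lebesgue_measure_unique (mu := pushforward mu phi)) => // _ [[a b]] _ <-.
rewrite /pushforward /=.
have E : (fun x => c - x) @^-1` [set` `]a, b]] = [set` `[c - b, c - a[].
  by apply/seteqP; split => x /=; rewrite !in_itv/= => /andP[? ?];
    apply/andP; split; lra.
rewrite [X in _ = lebesgue_measure X]E !lebesgue_measure_itv/= !lte_fin ltrD2l ltrN2.
by case: ifPn => // _; rewrite -!EFinB; congr EFin; ring.
Qed.

Lemma ge0_integral_reflect c f : measurable_fun setT f -> (forall x, 0 <= f x)%E ->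
  (\int[mu]_x f (c - x)%R = \int[mu]_x f x)%E.
Proof.
move=> mf f0.
transitivity (\int[pushforward mu (flip_at c)]_x f x)%E.
  by rewrite ge0_integral_pushforward//; exact: measurable_fun_reflect.
apply: eq_measure_integral => [|mflip A mA _].
- exact: measurable_fun_reflect.
- exact: lebesgue_measure_reflect.
Qed.

Lemma integral_reflect c f : measurable_fun setT f ->
  (\int[mu]_x f (c - x)%R = \int[mu]_x f x)%E.
Proof.
move=> mf; rewrite integralE [RHS]integralE; congr (_ - _)%E.
- by rewrite -(ge0_integral_reflect c (measurable_funepos mf))//;
    apply: eq_integral => x _; rewrite !funeposE.
- by rewrite -(ge0_integral_reflect c (measurable_funeneg mf))//;
    apply: eq_integral => x _; rewrite !funenegE.
Qed.

Lemma integral_translate c f : measurable_fun setT f ->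
  (\int[mu]_x f (x - c)%R = \int[mu]_x f x)%E.
Proof.
move=> mf; have mfc : measurable_fun setT (fun x : R => f (x - c)).
  by apply: (measurableT_comp mf); exact: measurable_funB.
(* A translation is a composite of two reflections: both sides become the integral of f(-x). *)
rewrite -(integral_reflect 0 mf) -(integral_reflect c mfc).
by apply: eq_integral => x _; congr f; ring.
Qed.

Lemma integrable_reflect c f : mu.-integrable setT f ->
  mu.-integrable setT (fun x => f (c - x)).
Proof.
move=> /integrableP[mf intf]; apply/integrableP; split.
  by apply: (measurableT_comp mf); exact: measurable_fun_reflect.
have maf : measurable_fun setT (abse \o f) by exact: measurableT_comp.
by rewrite (ge0_integral_reflect c maf)// => x; exact: abse_ge0.
Qed.

End Reflection.

(** * Locally integrable functions on the half-line and their convolution *)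

Section Causal.
Context {R : realType}.
Implicit Types (f g h : R -> R) (c t : R).
Local Notation mu := (@lebesgue_measure R).

(* This class contains C_{-1} and, unlike it, is seen to be stable under
   convolution without tracking exponents. *)
Definition locint f : Prop :=
  (forall t, 0 < t -> {for t, continuous f}) /\
  (forall T, mu.-integrable `]0, T[ (EFin \o f)).

(** Whole-line counterpart of [locint] without continuity: what one factor must satisfy when the
    other is continuous. *)
Definition causal g : Prop :=
  [/\ measurable_fun setT g, forall x, x <= 0 -> g x = 0
    & forall T, mu.-integrable setT (EFin \o (g \_ `]-oo, T[))].

Definition ext f : R -> R := f \_ `]0, +oo[.

Arguments ext : simpl never.

Lemma ext_pos f x : 0 < x -> ext f x = f x.
Proof. by move=> x0; rewrite /ext patchE mem_set//= in_itv/= x0. Qed.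

Lemma ext_nonpos f x : x <= 0 -> ext f x = 0.
Proof. by move=> x0; rewrite /ext patchE memNset//= in_itv/= andbT ltNge x0. Qed.

Lemma measurable_itvR (i : interval R) :
  measurable ([set` i] : set (measurableTypeR R)).
Proof. exact: measurable_itv. Qed.

Lemma patch_ext_nonpos f (D : set R) x : x <= 0 -> (ext f \_ D) x = 0.
Proof. by move=> x0; rewrite patchE ext_nonpos// if_same. Qed.

Lemma locint_measurable f : locint f -> measurable_fun setT (ext f).
Proof.
move=> [cf _]; apply/(measurable_restrictT _ _).1 => //.
apply: open_continuous_measurable_fun => //.
by move=> x; rewrite inE/= in_itv/= andbT => /cf.
Qed.

Lemma ext_causal f : locint f -> causal (ext f).
Proof.
move=> lf; split; first exact: locint_measurable.
- exact: ext_nonpos.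
- move=> T; have := lf.2 T; rewrite -(setTI [set` `]0, T[]) => fT.
  have := (integrable_restrict mu (measurable_itv `]0, T[) measurableT _).1 fT.
  apply: eq_integrable => // x _ /=.
  rewrite !patchE /= !mem_setE !in_itv/= /ext patchE mem_setE in_itv/= andbT.
  by case: (ltP 0 x) => //= _; case: ifP.
Qed.

Lemma causal_continuous_bounded h T : continuous h ->
  (forall x, x <= 0 -> h x = 0) -> exists M, forall x, x <= T -> `|h x| <= M.
Proof.
move=> ch h0; have [T0|T0] := leP 0 T; last first.
  by exists 0 => x xT; rewrite h0 ?normr0//; lra.
have cn : {within `[0, T], continuous (fun x => `|h x|)}.
  by apply: continuous_subspaceT => x; exact: cvg_norm (ch x).
have [c _ cM] := EVT_max T0 cn.
exists `|h c| => x xT; have [x0|x0] := leP x 0.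
  by rewrite h0// normr0.
by apply: cM; rewrite in_itv/= xT ltW.
Qed.

(** The product vanishes unless 0 < x < t, so a single bound of [h] on []-oo, v]] serves all t < v.
    This uniformity in t is what dominated convergence needs. *)
Lemma conv_dominated h g v : continuous h -> (forall x, x <= 0 -> h x = 0) ->
  causal g -> exists M, forall t x, t < v ->
    `|h (t - x) * g x| <= `|M * (g \_ `]-oo, v[) x|.
Proof.
move=> ch h0 [_ g0 _]; have [M hM] := causal_continuous_bounded v ch h0.
exists M => t x tv; have [x0|x0] := leP x 0.
  by rewrite g0// mulr0 normr0.
have [xv|vx] := ltP x v; last first.
  by rewrite h0 ?mul0r ?normr0//; lra.
rewrite patchE mem_set ?in_itv//= !normrM ler_wpM2r//.
by rewrite (le_trans _ (ler_norm _))//; apply: hM; lra.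
Qed.

Lemma conv_integrand_measurable h g t : measurable_fun setT h ->
  measurable_fun setT g -> measurable_fun setT (fun x : R => h (t - x) * g x).
Proof.
move=> mh mg; apply: measurable_funM => //.
by apply: (measurableT_comp mh); exact: measurable_funB.
Qed.

Lemma conv_continuous_integrable h g t : continuous h ->
  (forall x, x <= 0 -> h x = 0) -> causal g ->
  mu.-integrable setT (fun x => (h (t - x) * g x)%:E).
Proof.
move=> ch h0 cg; have [mg _ ig] := cg.
have [M hM] := conv_dominated (t + 1) ch h0 cg.
apply: (le_integrable _ _ _ (integrableZl _ M (ig (t + 1)))) => //.
- apply/measurable_EFinP; apply: conv_integrand_measurable => //.
  exact: continuous_measurable_fun.
- by move=> x _; rewrite -EFinM !abse_EFin lee_fin; apply: hM; lra.
Qed.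

Lemma conv_continuous_continuous h g : continuous h ->
  (forall x, x <= 0 -> h x = 0) -> causal g ->
  continuous (fun t => \int[mu]_x (h (t - x) * g x)).
Proof.
move=> ch h0 cg t; have [mg _ ig] := cg.
have [M hM] := conv_dominated (t + 1) ch h0 cg.
apply: (@continuity_under_integral R _ _ mu (fun t x => h (t - x) * g x) setT
  _ (t - 1) (t + 1) _ _ (fun x => `|M * (g \_ `]-oo, t + 1[) x|)) => //.
- by move=> s _; exact: conv_continuous_integrable.
- apply: aeW => x _ s _; apply: cvgM; last exact: cvg_cst.
  apply: (@continuous_comp _ _ _ (fun s => s - x)); last exact: ch.
  by apply: cvgB; [exact: cvg_id|exact: cvg_cst].
- apply: integrable_norm; exact: (integrableZl _ M (ig (t + 1))).
- move=> s /=; rewrite in_itv/= => /andP[_ st]; apply: aeW => x _; exact: hM.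
- by rewrite inE/= in_itv/=; apply/andP; split; lra.
Qed.

(* [ext f] is the sum of [tail_part c f], continuous on the whole line, and
   [head_part c f], supported in [0, c].  For t > 2c the two heads do not
   interact in (f * g)(t), so near such t all the products left have a factor
   that is continuous and bounded: this gives the integrability and the
   continuity of the convolution away from 0. *)
Definition cutoff c x : R := Num.max 0 (Num.min 1 (2 * x / c - 1)).

Lemma cutoff_ge0_le1 c x : 0 <= cutoff c x <= 1.
Proof. by rewrite /cutoff le_max lexx/= ge_max ler01 ge_min lexx. Qed.

Lemma cutoff_small c x : 0 < c -> x <= c / 2 -> cutoff c x = 0.
Proof.
move=> c0 xc; apply: max_l; rewrite ge_min; apply/orP; right.
rewrite subr_le0 ler_pdivrMr//; lra.
Qed.

Lemma cutoff_large c x : 0 < c -> c <= x -> cutoff c x = 1.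
Proof.
move=> c0 xc; rewrite /cutoff min_l ?max_r ?ler01//.
by rewrite lerBrDr ler_pdivlMr//; lra.
Qed.

Lemma continuous_cutoff c : continuous (cutoff c).
Proof.
move=> x.
apply: (@continuous_max R R (fun=> 0) (fun x => Num.min 1 (2 * x / c - 1))).
  exact: cvg_cst.
apply: (@continuous_min R R (fun=> 1) (fun x => 2 * x / c - 1)).
  exact: cvg_cst.
apply: cvgB; last exact: cvg_cst.
apply: cvgM; last exact: cvg_cst.
by apply: cvgM; [exact: cvg_cst|exact: cvg_id].
Qed.

Definition tail_part c f x : R := ext f x * cutoff c x.
Definition head_part c f x : R := ext f x * (1 - cutoff c x).

Lemma tail_part_nonpos c f x : x <= 0 -> tail_part c f x = 0.
Proof. by move=> x0; rewrite /tail_part ext_nonpos ?mul0r. Qed.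

Lemma continuous_tail_part c f : 0 < c -> locint f -> continuous (tail_part c f).
Proof.
move=> c0 [cf _] x; have [x0|x0] := ltP 0 x.
  apply: cvgM; last exact: continuous_cutoff.
  rewrite ext_pos//; apply: (cvg_trans _ (cf x x0)).
  apply: near_eq_cvg; near=> y; rewrite ext_pos//.
  by near: y; exact: lt_nbhsr.
(* The tail vanishes identically up to c/2, so a singularity of f at 0 does no harm. *)
rewrite /continuous_at tail_part_nonpos//.
apply: cvg_near_cst; near=> y; rewrite /tail_part cutoff_small ?mulr0//.
by apply: ltW; near: y; apply: lt_nbhsl; lra.
Unshelve. all: by end_near. Qed.

Lemma head_part_causal c f : locint f -> causal (head_part c f).
Proof.
move=> lf; have [mf f0 intf] := ext_causal lf.
have mhead : measurable_fun setT (head_part c f).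
  apply: measurable_funM => //; apply: measurable_funB => //.
  by apply: continuous_measurable_fun; exact: continuous_cutoff.
split => //.
- by move=> x x0; rewrite /head_part f0// mul0r.
- move=> T; apply: (le_integrable _ _ _ (intf T)) => //.
    apply/measurable_EFinP/(measurable_restrictT _ _).1 => //.
    exact: measurable_funS mhead.
  move=> x _; rewrite !abse_EFin lee_fin !patchE; case: ifP => // _.
  rewrite /head_part normrM ler_piMr//.
  by have /andP[? ?] := cutoff_ge0_le1 c x; rewrite ger0_norm; lra.
Qed.

Lemma head_part_large c f x : 0 < c -> c <= x -> head_part c f x = 0.
Proof. by move=> c0 cx; rewrite /head_part cutoff_large// subrr mulr0. Qed.

Lemma conv_integrand_split c f g t x : 0 < c -> 2 * c < t ->
  ext f (t - x) * ext g x =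
  tail_part c f (t - x) * ext g x + tail_part c g x * head_part c f (t - x).
Proof.
move=> c0 ct.
have fE : ext f (t - x) = tail_part c f (t - x) + head_part c f (t - x).
  by rewrite /tail_part /head_part -mulrDr subrKC mulr1.
have gE : ext g x = tail_part c g x + head_part c g x.
  by rewrite /tail_part /head_part -mulrDr subrKC mulr1.
(* Either x >= c, or t - x > c because t > 2c: one of the two heads is always zero. *)
have : head_part c f (t - x) * head_part c g x = 0.
  have [cx|xc] := leP c x; first by rewrite [X in _ * X]head_part_large// mulr0.
  by rewrite head_part_large ?mul0r//; lra.
rewrite fE mulrDl; set a := tail_part _ _ _ * _ => Z; rewrite gE mulrDr Z addr0.
by congr (_ + _); rewrite mulrC.
Qed.

End Causal.

(** * Existence, commutativity and continuity of the convolution *)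

Section Convolution.
Context {R : realType}.
Implicit Types (f g h : R -> R) (c t : R).
Local Notation mu := (@lebesgue_measure R).
Local Notation conv := Defs.conv.

Lemma conv_ext f g t : conv f g t = \int[mu]_x (ext f (t - x) * ext g x).
Proof.
rewrite /conv Rintegral_mkcond; apply: eq_Rintegral => x _.
rewrite patchE; case: ifPn.
  rewrite inE/= in_itv/= => /andP[x0 xt].
  by rewrite !ext_pos// subr_gt0.
rewrite notin_setE/= in_itv/= => /negP; rewrite negb_and -!leNgt => /orP[x0|tx].
  by rewrite (ext_nonpos _ x0) mulr0.
by rewrite ext_nonpos ?mul0r// subr_le0.
Qed.

Lemma conv_nonpos f g t : t <= 0 -> conv f g t = 0.
Proof. by move=> t0; rewrite /conv set_itv_ge ?Rintegral_set0// bnd_simp -leNgt. Qed.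

(** For t <= 0 the interval of integration is empty. This lets nested convolutions be unfolded
    without a case distinction. *)
Lemma ext_conv f g t : ext (conv f g) t = conv f g t.
Proof.
have [t0|t0] := ltP 0 t; first by rewrite ext_pos.
by rewrite ext_nonpos// conv_nonpos.
Qed.

Lemma eq_conv f f' g g' t : (forall x, 0 < x -> f x = f' x) ->
  (forall x, 0 < x -> g x = g' x) -> conv f g t = conv f' g' t.
Proof.
move=> ff gg; apply: eq_Rintegral => x; rewrite inE/= in_itv/= => /andP[x0 xt].
by rewrite gg// ff// subr_gt0.
Qed.

(** For t > 0 both pieces of the splitting have a continuous factor; the reflection x -> t - x
    brings the second piece to the form handled by [conv_continuous_integrable]. *)
Lemma conv_integrable f g t : locint f -> locint g ->
  mu.-integrable setT (fun x => (ext f (t - x) * ext g x)%:E).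
Proof.
move=> lf lg; have [t0|t0] := leP t 0.
  apply: (eq_integrable measurableT _ _ _ (integrable0 mu setT)) => x _ /=.
  have [x0|x0] := leP x 0; first by rewrite (ext_nonpos g x0) mulr0.
  by rewrite ext_nonpos ?mul0r//; lra.
have c0 : 0 < t / 4 by lra.
have i1 := conv_continuous_integrable t (continuous_tail_part c0 lf)
  (@tail_part_nonpos _ _ _) (ext_causal lg).
have i2 := conv_continuous_integrable t (continuous_tail_part c0 lg)
  (@tail_part_nonpos _ _ _) (head_part_causal (t / 4) lf).
apply: (eq_integrable measurableT _ _ _
  (integrableD measurableT i1 (integrable_reflect t i2))) => x _ /=.
rewrite -EFinD (@conv_integrand_split _ (t / 4))//; last lra.
by rewrite subKr.
Qed.

Lemma convC f g t : locint f -> locint g -> conv f g t = conv g f t.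
Proof.
move=> lf lg; rewrite !conv_ext; congr fine.
have /measurable_int mfg := conv_integrable t lf lg.
rewrite -(integral_reflect t mfg); apply: eq_integral => x _.
by rewrite subKr mulrC.
Qed.

(** The second integral is reflected so that in both of them t enters only through the continuous
    factor, as [conv_continuous_continuous] requires. *)
Lemma conv_split c f g t : 0 < c -> 2 * c < t -> locint f -> locint g ->
  conv f g t = \int[mu]_x (tail_part c f (t - x) * ext g x) +
               \int[mu]_x (tail_part c g (t - x) * head_part c f x).
Proof.
move=> c0 ct lf lg.
have i1 := conv_continuous_integrable t (continuous_tail_part c0 lf)
  (@tail_part_nonpos _ _ _) (ext_causal lg).
have i2 := conv_continuous_integrable t (continuous_tail_part c0 lg)
  (@tail_part_nonpos _ _ _) (head_part_causal c lf).
have i3 := integrable_reflect t i2.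
rewrite conv_ext.
under eq_Rintegral do rewrite (conv_integrand_split _ _ _ c0 ct).
rewrite RintegralD//; last first.
  by apply: (eq_integrable measurableT _ _ _ i3) => x _ /=; rewrite subKr.
congr (_ + _); congr fine.
have /measurable_int m2 := i2.
rewrite -(integral_reflect t m2); apply: eq_integral => x _.
by rewrite subKr.
Qed.

Lemma conv_continuous_at f g t : locint f -> locint g -> 0 < t ->
  {for t, continuous (conv f g)}.
Proof.
(* With c = t/4 the condition 2c < s holds for all s near t, so one splitting serves a whole
   neighbourhood. *)
move=> lf lg t0; have c0 : 0 < t / 4 by lra.
have ct : 2 * (t / 4) < t by lra.
rewrite /prop_for /continuous_at (conv_split c0 ct lf lg).
apply: (@cvg_trans _ ((fun s =>
    \int[mu]_x (tail_part (t / 4) f (s - x) * ext g x) +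
    \int[mu]_x (tail_part (t / 4) g (s - x) * head_part (t / 4) f x)) @ t)).
  apply: near_eq_cvg; near=> s; rewrite (conv_split c0 _ lf lg)//.
  by near: s; apply: lt_nbhsr; lra.
have c1 := conv_continuous_continuous (continuous_tail_part c0 lf)
  (@tail_part_nonpos _ _ _) (ext_causal lg).
have c2 := conv_continuous_continuous (continuous_tail_part c0 lg)
  (@tail_part_nonpos _ _ _) (head_part_causal (t / 4) lf).
exact: cvgD (c1 t) (c2 t).
Unshelve. all: by end_near. Qed.

Lemma locint_norm f : locint f -> locint (fun x => `|f x|).
Proof.
move=> [cf intf]; split; first by move=> t t0; exact: cvg_norm (cf t t0).
by move=> T; exact: integrable_norm (intf T).
Qed.

Lemma measurable_conv_kernel f g : measurable_fun setT f -> measurable_fun setT g ->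
  measurable_fun setT (fun z : R * R => f (z.1 - z.2) * g z.2).
Proof.
move=> mf mg; apply: measurable_funM.
  by apply: (measurableT_comp mf); apply: measurable_funB;
    [exact: measurable_fst|exact: measurable_snd].
by apply: (measurableT_comp mg); exact: measurable_snd.
Qed.

(** By Tonelli and translation invariance, the double integral of the absolute value is the product
    of the two L^1 norms. *)
Lemma conv_kernel_integrable f g :
  mu.-integrable setT (EFin \o f) -> mu.-integrable setT (EFin \o g) ->
  (mu \x mu)%E.-integrable setT (fun z : R * R => (f (z.1 - z.2) * g z.2)%:E).
Proof.
move=> /integrableP[/measurable_EFinP mf intf] /integrableP[/measurable_EFinP mg intg].
apply/integrable21ltyP.
  by apply/measurable_EFinP; exact: measurable_conv_kernel.
have mnf : measurable_fun setT (fun x => `|f x|%:E).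
  by apply/measurable_EFinP; exact: measurableT_comp.
under eq_integral.
  move=> y _.
  under eq_integral do rewrite /= normrM mulrC EFinM.
  rewrite ge0_integralZl//; last first.
    apply: (measurableT_comp mnf); exact: measurable_funB.
  rewrite (integral_translate y mnf).
  over.
rewrite /= ge0_integralZr//.
- by rewrite lte_mul_pinfty ?ge0_fin_numE ?integral_ge0.
- by apply/measurable_EFinP; exact: measurableT_comp.
- exact: integral_ge0.
Qed.

Lemma locint_conv f g : locint f -> locint g -> locint (conv f g).
Proof.
move=> lf lg; split; first by move=> t; exact: conv_continuous_at.
(* Below T the convolution only sees values of f and g below T, so both may be truncated there to
   integrable functions on the line. *)
move=> T; have [_ _ /(_ T) intf] := ext_causal lf.
have [_ _ /(_ T) intg] := ext_causal lg.
have := integrableS measurableT (measurable_itvR `]0, T[) (@subsetT _ _)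
  (integrable_fubini_F (conv_kernel_integrable intf intg)).
apply: eq_integrable => // t; rewrite inE/= in_itv/= => /andP[t0 tT].
rewrite /fubini_F conv_ext /Rintegral fineK; last first.
  by apply: integrable_fin_num => //; exact: conv_integrable.
apply: eq_integral => x _ /=; congr EFin.
have [x0|x0] := leP x 0; first by
  rewrite (patch_ext_nonpos g _ x0) (ext_nonpos g x0) !mulr0.
have [tx|xt] := leP t x.
  have tx0 : t - x <= 0 by lra.
  by rewrite (patch_ext_nonpos f _ tx0) (ext_nonpos f tx0) !mul0r.
by rewrite !patchE !mem_set//= in_itv/=; lra.
Qed.

End Convolution.

(** * Associativity, linearity and iterates of the convolution *)

Section ConvolutionAlgebra.
Context {R : realType}.
Implicit Types (f g h : R -> R) (c t : R).
Local Notation mu := (@lebesgue_measure R).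
Local Notation conv := Defs.conv.

Lemma EFin_conv f g t : locint f -> locint g ->
  (\int[mu]_x (ext f (t - x) * ext g x)%:E = (conv f g t)%:E)%E.
Proof.
move=> lf lg; rewrite conv_ext /Rintegral fineK//.
by apply: integrable_fin_num => //; exact: conv_integrable.
Qed.

Lemma ext_norm f x : `|ext f x| = ext (fun x => `|f x|) x.
Proof.
have [x0|x0] := ltP 0 x; first by rewrite !ext_pos.
by rewrite !ext_nonpos// normr0.
Qed.

(** The iterated integral of the absolute value is |f| * (|g| * |h|) at t, finite since these
    functions are again [locint]. *)
Lemma conv_conv_integrable f g h t : locint f -> locint g -> locint h ->
  (mu \x mu)%E.-integrable setT
    (fun z : R * R => (ext f (t - z.1) * (ext g (z.1 - z.2) * ext h z.2))%:E).
Proof.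
move=> lf lg lh; apply/integrable12ltyP.
  apply/measurable_EFinP; apply: measurable_funM.
    apply: (measurableT_comp (locint_measurable lf)).
    by apply: measurable_funB => //; exact: measurable_fst.
  by apply: measurable_conv_kernel; exact: locint_measurable.
have lnf := locint_norm lf; have lng := locint_norm lg; have lnh := locint_norm lh.
have lgh := locint_conv lng lnh.
apply: le_lt_trans (integrable_lty measurableT (conv_integrable t lnf lgh)).
rewrite le_eqVlt; apply/orP; left; apply/eqP; apply: eq_integral => s _.
rewrite ext_conv EFinM -EFin_conv// -integralZl//; last exact: conv_integrable.
by apply: eq_integral => x _; rewrite /= !normrM !ext_norm EFinM.
Qed.

Lemma convA f g h t : locint f -> locint g -> locint h ->
  conv (conv f g) h t = conv f (conv g h) t.
Proof.
move=> lf lg lh; apply: EFin_inj.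
have lfg := locint_conv lf lg; have lgh := locint_conv lg lh.
rewrite -!EFin_conv//.
(* Shifting the inner variable by y turns t - y - s into t - s, so f no longer depends on y and the
   order of integration can be exchanged. *)
transitivity (\int[mu]_y \int[mu]_s
  (ext f (t - s) * (ext g (s - y) * ext h y))%:E)%E.
  apply: eq_integral => y _; rewrite ext_conv EFinM -EFin_conv//.
  have i1 := conv_integrable (t - y) lf lg.
  have m1 : measurable_fun setT
      (fun s : R => (ext f (t - y - s) * ext g s)%:E * (ext h y)%:E)%E.
    exact: (measurable_int mu (integrableZr measurableT (ext h y) i1)).
  rewrite -integralZr// -(integral_translate y m1).
  apply: eq_integral => s _; rewrite -EFinM; congr EFin.
  by rewrite mulrA; congr (ext f _ * _ * _); ring.
rewrite -(Fubini (conv_conv_integrable t lf lg lh))/=.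
apply: eq_integral => s _; rewrite ext_conv EFinM -EFin_conv// -integralZl//.
exact: conv_integrable.
Qed.

Lemma convCA f g h t : locint f -> locint g -> locint h ->
  conv f (conv g h) t = conv g (conv f h) t.
Proof.
move=> lf lg lh; rewrite -(convA t lf lg lh) -(convA t lg lf lh).
by apply: (eq_conv t _ (fun _ _ => erefl)) => x _; exact: convC.
Qed.

Lemma eq_locint f g : (forall x, 0 < x -> f x = g x) -> locint f -> locint g.
Proof.
move=> fg [cf intf]; split.
  move=> t t0; rewrite /prop_for /continuous_at -fg//.
  apply: cvg_trans (cf t t0); apply: near_eq_cvg; near=> s.
  by rewrite fg//; near: s; exact: lt_nbhsr.
move=> T; apply: (eq_integrable (measurable_itvR _) _ _ _ (intf T)) => x.
by rewrite /= inE/= in_itv/= => /andP[x0 _]; rewrite fg.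
Unshelve. all: by end_near. Qed.

Lemma locintD f g : locint f -> locint g -> locint (fun x => f x + g x).
Proof.
move=> [cf intf] [cg intg]; split.
  by move=> t t0; exact: cvgD (cf t t0) (cg t t0).
move=> T; have := integrableD (measurable_itvR _) (intf T) (intg T).
by apply: eq_integrable => //; exact: measurable_itvR.
Qed.

Lemma locintZ c f : locint f -> locint (fun x => c * f x).
Proof.
move=> [cf intf]; split.
  by move=> t t0; exact: cvgM (cvg_cst c) (cf t t0).
move=> T; have := integrableZl (measurable_itvR _) c (intf T).
by apply: eq_integrable => //; exact: measurable_itvR.
Qed.

Lemma continuous_locint f : continuous f -> locint f.
Proof.
move=> cf; split => [t _|T]; first exact: cf.
have := continuous_compact_integrable (@segment_compact _ 0 T)
  (continuous_subspaceT cf).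
apply: integrableS; [exact: measurable_itvR|exact: measurable_itvR|].
exact: subset_itv_oo_cc.
Qed.

Lemma locint_cst c : locint (fun=> c).
Proof. by apply: continuous_locint => x; exact: cvg_cst. Qed.

Lemma locint_sum n (F : 'I_n -> R -> R) : (forall i, locint (F i)) ->
  locint (fun x => \sum_(i < n) F i x).
Proof.
elim: n F => [|n ih] F lF.
  by apply: eq_locint (locint_cst 0) => x _; rewrite big_ord0.
apply: eq_locint (locintD (lF ord0) (ih (fun i => F (lift ord0 i)) _)) => //.
by move=> x _; rewrite big_ord_recl.
Qed.

Lemma convDr f g h t : locint f -> locint g -> locint h ->
  conv f (fun x => g x + h x) t = conv f g t + conv f h t.
Proof.
move=> lf lg lh; rewrite !conv_ext -RintegralD//; try exact: conv_integrable.
apply: eq_Rintegral => x _; rewrite -mulrDr; congr (_ * _).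
have [x0|x0] := ltP 0 x; first by rewrite !ext_pos.
by rewrite !ext_nonpos// addr0.
Qed.

Lemma convZr c f g t : locint f -> locint g ->
  conv f (fun x => c * g x) t = c * conv f g t.
Proof.
move=> lf lg; rewrite !conv_ext -RintegralZl//; last exact: conv_integrable.
apply: eq_Rintegral => x _; rewrite mulrCA; congr (_ * _).
have [x0|x0] := ltP 0 x; first by rewrite !ext_pos.
by rewrite !ext_nonpos// mulr0.
Qed.

Lemma conv_sumr n f (F : 'I_n -> R -> R) t : locint f -> (forall i, locint (F i)) ->
  conv f (fun x => \sum_(i < n) F i x) t = \sum_(i < n) conv f (F i) t.
Proof.
move=> lf; elim: n F => [|n ih] F lF.
  (* The empty sum is written as the multiple 0 * 1 to make [convZr] applicable. *)
  rewrite big_ord0 (@eq_conv _ f f _ (fun x => 0 * 1)) => [|//|x _]; last first.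
    by rewrite big_ord0 mul0r.
  by rewrite convZr ?mul0r//; exact: locint_cst.
rewrite big_ord_recl -ih// -convDr//; last exact: locint_sum.
by apply: eq_conv => // x _; rewrite big_ord_recl.
Qed.

Lemma locint_iter_conv a n f : locint a -> locint f -> locint (iter n (conv a) f).
Proof. by move=> la lf; elim: n => //= n; exact: locint_conv. Qed.

Lemma eq_iter_conv a n f g t : (forall x, 0 < x -> f x = g x) -> 0 < t ->
  iter n (conv a) f t = iter n (conv a) g t.
Proof.
by move=> fg; elim: n t => [t|n ih t t0]/=; [exact: fg|exact: eq_conv].
Qed.

Lemma iter_convCA a b n f t : locint a -> locint b -> locint f ->
  iter n (conv a) (conv b f) t = conv b (iter n (conv a) f) t.
Proof.
move=> la lb lf; elim: n t => //= n ih t.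
rewrite -convCA//; last exact: locint_iter_conv.
by apply: eq_conv => // x _; exact: ih.
Qed.

(** Reassociation of n factors [k]. Positivity of [n] matters: [conv_pow k 0] is [k], whereas zero
    iterations give back [f]. *)
Lemma conv_powE k n f t : (0 < n)%N -> locint k -> locint f ->
  conv (conv_pow k n) f t = iter n (conv k) f t.
Proof.
move=> + lk lf; case: n => // n _; rewrite /conv_pow/=.
elim: n t => [//|n ih] t.
rewrite [LHS](convA t lk (locint_iter_conv n lk lk) lf).
by apply: (eq_conv t (fun _ _ => erefl)) => x _; exact: ih.
Qed.

Lemma locint_conv_pow (k : R -> R) n : locint k -> locint (conv_pow k n).
Proof. by move=> lk; exact: locint_iter_conv. Qed.

End ConvolutionAlgebra.

(** * Power singularities at 0 *)

Section PowerSingularity.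
Context {R : realType}.
Implicit Types (f g h : R -> R) (c t : R).
Local Notation mu := (@lebesgue_measure R).
Local Notation conv := Defs.conv.

Lemma is_derive_powR_div (p x : R) : 0 < p -> 0 < x ->
  is_derive x 1 (fun y => y `^ p / p) (x `^ (p - 1)).
Proof.
move=> p0 x0.
rewrite (_ : (fun y => _) = p^-1 \*: (fun y : R => y `^ p)); last first.
  by apply/funext => y; rewrite /= mulrC.
apply: is_derive_eq; first exact: (is_deriveZ _ (is_derive1_powR p x0)).
by rewrite /GRing.scale/= mulrA mulVf ?mul1r ?gt_eqF.
Qed.

(** The integrand may blow up at 0, so the fundamental theorem is applied away from 0; the bound is
    independent of [a] and survives a -> 0. *)
Lemma integral_powR_le (p a T : R) : 0 < p -> 0 < a -> 0 < T ->
  (\int[mu]_(x in `[a, T]) (x `^ (p - 1))%:E <= (T `^ p / p)%:E)%E.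
Proof.
move=> p0 a0 T0; have Tp : 0 <= T `^ p / p by rewrite divr_ge0 ?powR_ge0// ltW.
have [Ta|aT] := ltP T a; first by
  rewrite set_itv_ge ?integral_set0 ?lee_fin// bnd_simp -ltNge.
move: aT; rewrite le_eqVlt => /predU1P[->|aT].
  by rewrite set_itv1 integral_set1 lee_fin.
have dF x : 0 < x -> derivable (fun y : R => y `^ p / p) x 1.
  by move=> x0; have [] := is_derive_powR_div p0 x0.
have cF x : 0 < x -> {for x, continuous (fun y : R => y `^ p / p)}.
  by move=> x0; apply: differentiable_continuous; apply/derivable1_diffP; exact: dF.
have cpow (q x : R) : 0 < x -> {for x, continuous (fun y : R => y `^ q)}.
  move=> x0; apply: differentiable_continuous; apply/derivable1_diffP.
  by have [] := is_derive1_powR q x0.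
rewrite (@continuous_FTC2 _ (fun x => x `^ (p - 1)) (fun y => y `^ p / p) a T)//.
- by rewrite -EFinB lee_fin gerBl divr_ge0 ?powR_ge0// ltW.
- apply: continuous_in_subspaceT => x; rewrite inE/= in_itv/= => /andP[ax _].
  by apply: cpow; lra.
- split.
  + by move=> x; rewrite in_itv/= => /andP[ax _]; apply: dF; lra.
  + exact: cvg_at_right_filter (cF a a0).
  + exact: cvg_at_left_filter (cF T T0).
- move=> x; rewrite in_itv/= => /andP[ax _].
  have x0 : 0 < x by lra.
  by rewrite derive1E; have [] := is_derive_powR_div p0 x0.
Qed.

Lemma integrable_powR (p T : R) : 0 < p ->
  mu.-integrable `]0, T[ (fun x => (x `^ (p - 1))%:E).
Proof.
move=> p0; have [T0|T0] := leP T 0.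
  by rewrite set_itv_ge ?bnd_simp -?leNgt//; exact: integrable_set0.
have mp (D : set (measurableTypeR R)) : measurable_fun D (fun x => (x `^ (p - 1))%:E).
  by apply/measurable_EFinP; apply: measurable_funTS; exact: measurable_powR.
apply/integrableP; split; first exact: mp.
under eq_integral do rewrite abse_EFin ger0_norm ?powR_ge0//.
(* These intervals increase to []0, T]]; monotone convergence carries the uniform bound to the
   limit. *)
pose F n := [set` `[n.+1%:R^-1, T]] : set (measurableTypeR R).
have ndF : {homo F : n m / (n <= m)%N >-> (n <= m)%O}.
  move=> n m nm; apply/subsetPset => x; rewrite /F/= !in_itv/= => /andP[nx ->].
  by rewrite andbT (le_trans _ nx)// lef_pV2 ?posrE// ler_nat.
have f0 n x : F n x -> (0 <= (x `^ (p - 1))%:E)%E by rewrite lee_fin powR_ge0.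
have lim := ge0_nondecreasing_set_cvg_integral (mu := mu) ndF
  (fun=> measurable_itvR _) (fun=> mp _) f0.
apply: (@le_lt_trans _ _ (T `^ p / p)%:E); last exact: ltry.
apply: (@le_trans _ _ (\int[mu]_(x in \bigcup_i F i) (x `^ (p - 1))%:E)%E).
  apply: ge0_subset_integral.
  - exact: measurable_itvR.
  - by apply: bigcupT_measurable => n; exact: measurable_itvR.
  - exact: mp.
  - by move=> x _; rewrite lee_fin powR_ge0.
  - move=> x /=; rewrite in_itv/= => /andP[x0 xT].
    have [n _ /(_ n (leqnn n))/= nx] := near_infty_natSinv_lt (PosNum x0).
    by exists n => //; rewrite /F/= in_itv/= !ltW.
rewrite -(cvg_lim _ lim)//; apply: lime_le.
  by apply/cvg_ex; eexists; exact: lim.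
by apply: nearW => n; apply: integral_powR_le => //; rewrite invr_gt0.
Qed.

(** Continuity of f1 up to 0 bounds it on [0, T], so f is dominated there by a multiple of t^(p-1),
    integrable because p > 0. *)
Lemma Cm1_locint f : Cm1 f -> locint f.
Proof.
move=> [p [f1 [p0 cf1 fE]]].
have cf t : 0 < t -> {for t, continuous f}.
  move=> t0; rewrite /prop_for /continuous_at fE//.
  apply: (@cvg_trans _ ((fun s => s `^ (p - 1) * f1 s) @ t)).
    apply: near_eq_cvg; near=> s; rewrite fE//.
    by near: s; exact: lt_nbhsr.
  have cpow : {for t, continuous (fun s : R => s `^ (p - 1))}.
    apply: differentiable_continuous; apply/derivable1_diffP.
    by have [] := is_derive1_powR (p - 1) t0.
  have [+ _] := (continuous_within_itvcyP _ _).1 cf1.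
  move=> /(_ t); rewrite in_itv/= andbT => /(_ t0) cf1t.
  exact: cvgM cpow cf1t.
split => // T; have [T0|T0] := leP T 0.
  by rewrite set_itv_ge ?bnd_simp -?leNgt//; exact: integrable_set0.
have cn : {within `[0, T], continuous (fun x => `|f1 x|)}.
  have sub : [set` `[0, T]] `<=` ([set` `[0, +oo[] : set R).
    by move=> x/=; rewrite !in_itv/= => /andP[->].
  apply: (continuous_subspaceW sub) => x; apply: cvg_norm; exact: cf1.
have [c _ cM] := EVT_max (ltW T0) cn.
apply: (le_integrable _ _ _ (integrableZl _ `|f1 c| (integrable_powR T p0))).
- exact: measurable_itvR.
- apply/measurable_EFinP; apply: open_continuous_measurable_fun => //.
  by move=> x; rewrite inE/= in_itv/= => /andP[/cf].
- move=> x /=; rewrite in_itv/= => /andP[x0 xT].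
  rewrite lee_fin fE// mulrC !normrM ler_wpM2r// normr_id.
  by apply: cM; rewrite in_itv/= !ltW.
- exact: measurable_itvR.
Unshelve. all: by end_near. Qed.

Lemma Cm1_0_Cm1 f : Cm1_0 f -> Cm1 f.
Proof. by move=> [p [f1 [/andP[p0 _] ? ?]]]; exists p, f1. Qed.

End PowerSingularity.

(** * Convolution with 1 and iterated derivatives *)

Section Antiderivatives.
Context {R : realType}.
Implicit Types (f g h a : R -> R) (c t : R).
Local Notation mu := (@lebesgue_measure R).
Local Notation conv := Defs.conv.
Local Notation one := (fun=> 1 : R).

Lemma locint_integrable_oc a t : locint a -> mu.-integrable `]0, t] (EFin \o a).
Proof.
move=> [_ /(_ (t + 1))]; apply: integrableS.
- exact: measurable_itvR.
- exact: measurable_itvR.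
- by move=> x/=; rewrite !in_itv/= => /andP[-> xt]/=; lra.
Qed.

Lemma conv1E a t : locint a -> conv one a t = \int[mu]_(x in `]0, t]) a x.
Proof.
move=> la; rewrite -Rintegral_itv_bndo_bndc; last exact: la.2.
by apply: eq_Rintegral => x _; rewrite mul1r.
Qed.

Lemma is_derive_conv1 a t : locint a -> 0 < t ->
  is_derive t 1 (conv one a) (a t).
Proof.
move=> la t0; have tt1 : t < t + 1 by lra.
have [dF Fa] := continuous_FTC1 (a := BRight 0) tt1
  (locint_integrable_oc _ la) (t0 : (BRight 0 < BRight t)%O) (la.1 _ t0).
rewrite (_ : conv one a = fun y => \int[mu]_(x in `]0, y]) a x); last first.
  by apply/funext => y; exact: conv1E.
by apply: DeriveDef dF _; rewrite -derive1E.
Qed.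

Lemma conv1_cvg0 a : locint a -> conv one a t @[t --> 0^'+] --> 0.
Proof.
move=> la.
have ie : mu.-integrable `[0, 1] (EFin \o ext a).
  have [_ _ /(_ 2) i2] := ext_causal la.
  have := integrableS measurableT (measurable_itvR `[0, 1]) (@subsetT _ _) i2.
  apply: eq_integrable => [|x]; first exact: measurable_itvR.
  rewrite inE/= in_itv/= => /andP[x0 x1].
  by rewrite patchE mem_set//= in_itv/=; lra.
have := parameterized_integral_cvg_left ltr01 ie.
move=> /cvg_at_right_filter; apply: cvg_trans; apply: near_eq_cvg.
near=> t; have t1 : t <= 1 by near: t; exact: nbhs_right_le.
rewrite /parameterized_integral conv1E// -Rintegral_itv_obnd_cbnd.
  by apply: eq_Rintegral => x; rewrite inE/= in_itv/= => /andP[x0 _];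
    rewrite ext_pos.
apply: (eq_integrable (measurable_itvR _) _ _ _ (locint_integrable_oc t la)).
by move=> x; rewrite inE/= in_itv/= => /andP[x0 _]; rewrite /= ext_pos.
Unshelve. all: by end_near. Qed.

Lemma derive0_constant_pos f : (forall t, 0 < t -> is_derive t 1 f 0) ->
  forall t, 0 < t -> f t = f 1.
Proof.
move=> df.
have H s t : 0 < s -> s < t -> f t = f s.
  move=> s0 st; apply/eqP; rewrite -subr_eq0; apply/eqP.
  have [||c _ ->] := @MVT _ f (fun=> 0) s t st; last by rewrite mul0r.
    by move=> x; rewrite in_itv/= => /andP[sx _]; apply: df; lra.
  apply: derivable_within_continuous => x; rewrite in_itv/= => /andP[sx _].
  by have [] := df x; first lra.
move=> t t0; have [t1|t1|->//] := ltgtP t 1; first by rewrite -(H t 1).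
by rewrite (H 1 t).
Qed.

(** F - 1 * F' has derivative zero, hence is a constant; as 1 * F' tends to 0 at 0, that constant is
    the limit of F. The existence of the limit is thus a conclusion. *)
Lemma derivable_antiderivative F :
  (forall t, 0 < t -> derivable F t 1) -> locint (derive1 F) ->
  F x @[x --> 0^'+] --> lim (F x @[x --> 0^'+]) /\
  forall t, 0 < t -> F t = lim (F x @[x --> 0^'+]) + conv one (derive1 F) t.
Proof.
move=> dF lF'.
pose c := F 1 - conv one (derive1 F) 1.
have FE t : 0 < t -> F t = c + conv one (derive1 F) t.
  move=> t0; apply/eqP; rewrite -subr_eq; apply/eqP.
  apply: (derive0_constant_pos (f := fun t => F t - conv one (derive1 F) t)) => // s s0.
  have d1 : is_derive s 1 F (derive1 F s).
    by apply: DeriveDef; [exact: dF|rewrite derive1E].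
  have := is_deriveB d1 (is_derive_conv1 lF' s0).
  by rewrite subrr.
have Fc : F x @[x --> 0^'+] --> c.
  rewrite -[X in _ --> X]addr0.
  apply: (@cvg_trans _ ((fun x => c + conv one (derive1 F) x) @ 0^'+)).
    by apply: near_eq_cvg; near=> x; rewrite FE.
  by apply: cvgD; [exact: cvg_cst|exact: conv1_cvg0].
have -> : lim (F x @[x --> 0^'+]) = c by exact: cvg_lim.
by [].
Unshelve. all: by end_near. Qed.

End Antiderivatives.

(** * Iterated derivatives of functions compared only on the open half-line *)

Section IteratedDerivatives.
Context {R : realType}.
Implicit Types (f g b : R -> R) (c t : R).

Lemma eq_derive1n n f g : (forall t, 0 < t -> f t = g t) ->
  forall t, 0 < t -> derive1n n f t = derive1n n g t.
Proof.
move=> fg; elim: n => [|n ih] t t0; first exact: fg.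
rewrite !derive1nS !derive1E; apply: near_eq_derive; near=> s.
by apply: ih; near: s; exact: lt_nbhsr.
Unshelve. all: by end_near. Qed.

Lemma eq_nderivable n f g : (forall t, 0 < t -> f t = g t) ->
  nderivable n f -> nderivable n g.
Proof.
move=> fg df i ni t t0; apply: near_eq_derivable (df i ni t t0).
near=> s; apply: eq_derive1n => //.
by near: s; exact: lt_nbhsr.
Unshelve. all: by end_near. Qed.

Lemma nderivableW m n f : (m <= n)%N -> nderivable n f -> nderivable m f.
Proof. by move=> mn df i im; apply: df; exact: leq_trans mn. Qed.

Lemma derive1nD n f g : nderivable n f -> nderivable n g ->
  forall t, 0 < t -> derive1n n (fun x => f x + g x) t =
    derive1n n f t + derive1n n g t.
Proof.
elim: n => [//|n ih] df dg t t0.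
rewrite !derive1nS !derive1E.
rewrite -(deriveD (df n (ltnSn n) t t0) (dg n (ltnSn n) t t0)).
apply: near_eq_derive; near=> s; apply: ih;
  [exact: nderivableW df|exact: nderivableW dg|].
by near: s; exact: lt_nbhsr.
Unshelve. all: by end_near. Qed.

Lemma nderivableD n f g : nderivable n f -> nderivable n g ->
  nderivable n (fun x => f x + g x).
Proof.
move=> df dg i ni t t0.
apply: near_eq_derivable (derivableD (df i ni t t0) (dg i ni t t0)).
near=> s; apply/esym/derive1nD;
  [exact: nderivableW (ltnW ni) df|exact: nderivableW (ltnW ni) dg|].
by near: s; exact: lt_nbhsr.
Unshelve. all: by end_near. Qed.

Lemma derive1nZ n c f : nderivable n f ->
  forall t, 0 < t -> derive1n n (fun x => c * f x) t = c * derive1n n f t.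
Proof.
elim: n => [//|n ih] df t t0.
rewrite !derive1nS !derive1E.
rewrite -[RHS](deriveZ c (df n (ltnSn n) t t0)).
apply: near_eq_derive; near=> s; apply: ih; first exact: nderivableW df.
by near: s; exact: lt_nbhsr.
Unshelve. all: by end_near. Qed.

Lemma nderivableZ n c f : nderivable n f -> nderivable n (fun x => c * f x).
Proof.
move=> df i ni t t0; have := derivableZ (k := c) (df i ni t t0).
apply: near_eq_derivable; near=> s; apply/esym/derive1nZ.
  exact: nderivableW (ltnW ni) df.
by near: s; exact: lt_nbhsr.
Unshelve. all: by end_near. Qed.

Lemma derive1n0 n : derive1n n (fun=> 0 : R) = (fun=> 0 : R).
Proof.
elim: n => //= n ->; apply/funext => t.
by rewrite derive1E derive_cst.
Qed.

Lemma nderivable0 n : nderivable n (fun=> 0 : R).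
Proof. by move=> i _ t _; rewrite derive1n0; exact: derivable_cst. Qed.

Lemma nderivable_sum m n (F : 'I_m -> R -> R) : (forall i, nderivable n (F i)) ->
  nderivable n (fun x => \sum_(i < m) F i x).
Proof.
elim: m F => [|m ih] F dF.
  by apply: (eq_nderivable _ (@nderivable0 n)) => t _; rewrite big_ord0.
apply: eq_nderivable (nderivableD (dF ord0) (ih (fun i => F (lift ord0 i)) _)) => //.
by move=> t _; rewrite big_ord_recl.
Qed.

Lemma derive1n_sum m n (F : 'I_m -> R -> R) : (forall i, nderivable n (F i)) ->
  forall t, 0 < t ->
  derive1n n (fun x => \sum_(i < m) F i x) t = \sum_(i < m) derive1n n (F i) t.
Proof.
elim: m F => [|m ih] F dF t t0.
  rewrite big_ord0 (@eq_derive1n _ _ (fun=> 0)) ?derive1n0// => s _.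
  by rewrite big_ord0.
rewrite big_ord_recl -ih// -derive1nD//; last exact: nderivable_sum.
by apply: eq_derive1n => // s _; rewrite big_ord_recl.
Qed.

End IteratedDerivatives.

(** * Taylor expansion, the Sonine condition and the Caputo derivative *)

Section FundamentalTheorem.
Context {R : realType}.
Implicit Types (f g b : R -> R) (c t : R).
Local Notation conv := Defs.conv.
Local Notation one := (fun=> 1 : R).

Lemma derive1_conv1 b t : locint b -> 0 < t -> derive1 (conv one b) t = b t.
Proof. by move=> lb t0; rewrite derive1E; have [] := is_derive_conv1 lb t0. Qed.

Lemma derive1n_conv1 m b t : locint b -> 0 < t ->
  derive1n m.+1 (conv one b) t = derive1n m b t.
Proof.
move=> lb; rewrite derive1Sn; apply: eq_derive1n => s; exact: derive1_conv1.
Qed.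

Lemma nderivable_conv1 m b : locint b -> nderivable m b ->
  nderivable m.+1 (conv one b).
Proof.
move=> lb db [_ t t0|i im t t0]; first by have [] := is_derive_conv1 lb t0.
apply: near_eq_derivable (db i im t t0); near=> s; rewrite derive1n_conv1//.
by near: s; exact: lt_nbhsr.
Unshelve. all: by end_near. Qed.

Lemma derive1n_iter_conv1 j m b t : locint b -> 0 < t ->
  derive1n (j + m) (iter j (conv one) b) t = derive1n m b t.
Proof.
move=> lb t0; elim: j => [//|j ih]; rewrite addSn iterS derive1n_conv1//.
by apply: locint_iter_conv => //; exact: locint_cst.
Qed.

Lemma nderivable_iter_conv1 j m b : locint b -> nderivable m b ->
  nderivable (j + m) (iter j (conv one) b).
Proof.
move=> lb db; elim: j => // j ih; rewrite addSn iterS; apply: nderivable_conv1 => //.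
by apply: locint_iter_conv => //; exact: locint_cst.
Qed.

Definition monomial j t : R := t ^+ j / j`!%:R.

Lemma continuous_monomial j : continuous (monomial j).
Proof.
move=> t; apply: cvgM; last exact: cvg_cst.
exact: exprn_continuous.
Qed.

Lemma monomial0 t : monomial 0 t = 1.
Proof. by rewrite /monomial expr0 fact0 divr1. Qed.

Lemma is_derive_monomial j t :
  is_derive t 1 (monomial j) (j%:R * t ^+ j.-1 / j`!%:R).
Proof.
rewrite (_ : monomial j = (j`!%:R)^-1 \*: ((@idfun R) ^+ j)); last first.
  by apply/funext => s; rewrite /monomial fctE/= mulrC.
apply: is_derive_eq.
by rewrite /GRing.scale/= mulr1 mulrC.
Qed.

Lemma derivable_monomial j t : derivable (monomial j) t 1.
Proof. by have [] := is_derive_monomial j t. Qed.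

Lemma derive1_monomial j : derive1 (monomial j.+1) = monomial j.
Proof.
apply/funext => t; rewrite derive1E (@derive_val _ _ _ _ _ _ _ (is_derive_monomial _ _)).
rewrite /monomial/= factS natrM.
have j0 : j.+1%:R != 0 :> R by rewrite pnatr_eq0.
have f0 : j`!%:R != 0 :> R by rewrite pnatr_eq0 -lt0n fact_gt0.
by field; rewrite nat1r j0 f0.
Qed.

Lemma locint_monomial j : locint (monomial j).
Proof. by apply: continuous_locint; exact: continuous_monomial. Qed.

Lemma conv1_monomial j t : 0 < t -> conv one (monomial j) t = monomial j.+1 t.
Proof.
move=> t0; have [||m0 ->//] := @derivable_antiderivative _ (monomial j.+1).
- by move=> s _; exact: derivable_monomial.
- by rewrite derive1_monomial; exact: locint_monomial.
rewrite derive1_monomial (_ : lim _ = 0) ?add0r//.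
apply: cvg_lim => //; apply: cvg_at_right_filter.
have := @continuous_monomial j.+1 0.
by rewrite /continuous_at {2}/monomial expr0n/= mul0r.
Qed.

Lemma conv_monomial b j t : locint b -> 0 < t ->
  conv b (monomial j) t = iter j.+1 (conv one) b t.
Proof.
move=> lb t0; have l1 := locint_cst (1 : R).
elim: j t t0 => [|j ih] t t0.
  by rewrite /= [RHS]convC//; apply: eq_conv => // x _; rewrite monomial0.
rewrite iterS (@eq_conv _ b b _ (conv one (monomial j))) => [|//|x x0].
  rewrite (convCA t lb l1 (locint_monomial j)).
  exact: (eq_conv t (fun _ _ => erefl)).
by rewrite conv1_monomial.
Qed.

(** Local integrability is given for the top derivative alone. The induction hypothesis for f'
    writes f' as a polynomial plus an iterated integral, hence shows it is [locint], and f is then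
    recovered by [derivable_antiderivative]. *)
Lemma taylor n f : nderivable n f -> locint (derive1n n f) -> forall t, 0 < t ->
  f t = \sum_(j < n) derive1n0p j f * monomial j t
        + iter n (conv one) (derive1n n f) t.
Proof.
elim: n f => [|n ih] f df lf t t0; first by rewrite big_ord0 add0r.
have l1 := locint_cst (1 : R).
have {}ih : forall s, 0 < s -> derive1 f s =
    \sum_(j < n) derive1n0p j.+1 f * monomial j s
    + iter n (conv one) (derive1n n.+1 f) s.
  move=> s s0; rewrite (ih (derive1 f)) -?derive1Sn//.
    by congr (_ + _); apply: eq_bigr => j _; rewrite /derive1n0p -derive1Sn.
  by move=> i im u u0; rewrite -derive1Sn; exact: df.
have lF (j : 'I_n) : locint (fun s => derive1n0p j.+1 f * monomial j s).
  by apply: locintZ; exact: locint_monomial.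
have lI : locint (iter n (conv one) (derive1n n.+1 f)) by exact: locint_iter_conv.
have lS := locint_sum lF.
have lf' : locint (derive1 f).
  by apply: eq_locint (locintD lS lI) => s s0; rewrite ih.
have [|_ ->//] := @derivable_antiderivative _ f _ lf'; first exact: (df 0%N).
rewrite big_ord_recl monomial0 mulr1 -addrA; congr (_ + _).
rewrite (eq_conv t (g' := fun s => \sum_(j < n) derive1n0p j.+1 f * monomial j s
    + iter n (conv one) (derive1n n.+1 f) s) (fun _ _ => erefl) ih).
rewrite convDr// conv_sumr//; congr (_ + _); apply: eq_bigr => j _.
rewrite convZr//; last exact: locint_monomial.
by rewrite conv1_monomial.
Qed.

Lemma iter_conv_sonine kappa k n f t : locint kappa -> locint k -> locint f ->
  (forall s, 0 < s -> conv kappa k s = 1) -> 0 < t ->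
  iter n (conv kappa) (iter n (conv k) f) t = iter n (conv one) f t.
Proof.
move=> lkappa lk lf kk; elim: n t => [|n ih] t t0; first by [].
have lkf := locint_iter_conv n lk lf.
have lkkf := locint_iter_conv n lkappa lkf.
(* The outermost [k] is moved across the n inner copies of [kappa], to meet the remaining [kappa]
   and form kappa * k = 1. *)
rewrite !iterS (eq_conv t (fun _ _ => erefl)
  (fun x _ => iter_convCA n x lkappa lk lkf)).
by rewrite -(convA t lkappa lk lkkf); exact: eq_conv t kk ih.
Qed.

Lemma caputo_gfdE k n f : (0 < n)%N -> locint k -> nderivable n f ->
  locint (derive1n n f) -> caputo_gfd_defined k n f -> forall t, 0 < t ->
  caputo_gfd k n f t = conv (conv_pow k n) (derive1n n f) t.
Proof.
move=> n0 lk df lphi Dd t t0; set phi := derive1n n f; set K := conv_pow k n.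
have lK : locint K by exact: locint_conv_pow.
have l1 := locint_cst (1 : R).
have lKphi : locint (conv K phi) by exact: locint_conv.
have lI : locint (iter n (conv one) phi) by exact: locint_iter_conv.
have lF (j : 'I_n) : locint (fun s => derive1n0p j f * monomial j s).
  by apply: locintZ; exact: locint_monomial.
have lS := locint_sum lF.
have KfE s : 0 < s -> conv K f s =
    \sum_(j < n) derive1n0p j f * iter j.+1 (conv one) K s
    + iter n (conv one) (conv K phi) s.
  move=> s0; rewrite (eq_conv s (fun _ _ => erefl) (taylor df lphi)).
  rewrite convDr// conv_sumr// iter_convCA//; congr (_ + _).
  apply: eq_bigr => j _; rewrite convZr//; last exact: locint_monomial.
  by rewrite conv_monomial.
(* The j+1 integrations supply j+1 of the n derivatives; the other n-j-1 fall on [K] and come from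
   [Dd]. *)
have dIter (j : 'I_n) : derive1n0p j f != 0 -> nderivable n (iter j.+1 (conv one) K).
  move=> cj; have := @nderivable_iter_conv1 j.+1 (n - j.+1) K lK.
  by rewrite (subnKC (ltn_ord j)); apply;
    have := Dd j (ltn_ord j) cj; rewrite -subnDA addn1.
have dG (j : 'I_n) : nderivable n (fun s => derive1n0p j f * iter j.+1 (conv one) K s).
  have [->|cj] := eqVneq (derive1n0p j f) 0.
    by apply: (eq_nderivable _ (@nderivable0 R n)) => s _; rewrite mul0r.
  by apply: nderivableZ; exact: dIter.
have dI : nderivable n (iter n (conv one) (conv K phi)).
  by have := @nderivable_iter_conv1 n 0 _ lKphi; rewrite addn0; apply.
rewrite /caputo_gfd -/K (eq_derive1n n KfE t0).
rewrite (derive1nD (nderivable_sum dG) dI t0) (derive1n_sum dG t0).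
have -> : derive1n n (iter n (conv one) (conv K phi)) t = conv K phi t.
  by have := @derive1n_iter_conv1 n 0 _ _ lKphi t0; rewrite addn0.
rewrite addrAC -sumrB big1 ?add0r// => j _.
(* When the coefficient is zero, the derivative of [K] may be a default value, but it is multiplied
   by 0, and the function differentiated on the other side is zero. *)
have [cj|cj] := eqVneq (derive1n0p j f) 0.
  rewrite cj mul0r subr0 (@eq_derive1n _ _ _ (fun=> 0)) ?derive1n0// => s _.
  by rewrite mul0r.
rewrite (derive1nZ _ (dIter j cj) t0).
have := @derive1n_iter_conv1 j.+1 (n - j.+1) _ _ lK t0.
by rewrite (subnKC (ltn_ord j)) => ->; rewrite -subnDA addn1 subrr.
Qed.

End FundamentalTheorem.

Theorem theorem4p5 (R : realType) (kappa k : R -> R) (n : nat) (f : R -> R)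
    (kappa_S : Sm1 kappa) (k_assoc : associate_sonine kappa k)
    (n_gt0 : (0 < n)%N)
    (f_Cn : Cm1n n f) (Df_def : caputo_gfd_defined k n f) :
  forall t : R, 0 < t ->
    gfi kappa n (caputo_gfd k n f) t
    = f t - \sum_(j < n) derive1n0p j f * (t ^+ j / j`!%:R).
Proof.
move=> t t0.
have lkappa : locint kappa by apply/Cm1_locint/Cm1_0_Cm1; case: kappa_S.
have [k_S kk] := k_assoc; have lk : locint k by exact/Cm1_locint/Cm1_0_Cm1.
have [df /Cm1_locint lphi] := f_Cn.
(* The Caputo derivative is identified for s > 0 only, and iterated convolution at t > 0 reads no
   other values. *)
rewrite /gfi (@eq_iter_conv _ kappa n _ (iter n (Defs.conv k) (derive1n n f)))//; last first.
  by move=> s s0; rewrite caputo_gfdE// conv_powE.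
by rewrite iter_conv_sonine// [in RHS](taylor df lphi t0) addrC addKr.
Qed.
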